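(* Let $T=(X,\mathcal E,w)$ be a finite weighted tree, with tree distance $d_{T,w}=\sum_{e\in\mathcal E}w_e\,\delta_{S_e}$. Then the Arens–Eells norm of $(X,d_{T,w})$ is equal to the cut norm of the family $C=\{w_e\}_{e\in\mathcal E}$, that is, for every $\xi\in M_0(X)$, $$\|\xi\|_{\text{Æ}}=\|\xi\|_C=\sum_{e\in\mathcal E}w_e\Big|\sum_{x\in S_e}\xi(x)\Big| .$$
   Context: A weighted tree is a connected undirected graph $(X,\mathcal E)$ without cycles with a positive weight $w_e=w(x,y)$ on each edge $e=\{x,y\}$; the distance $d_{T,w}(x,y)$ is the sum of the weights along the path from $x$ to $y$. Each edge $e\in\mathcal E$, when removed, splits the vertex set $X$ into two disjoint connected components $S_e$ and $\bar S_e=X\setminus S_e$ (one of them is chosen as $S_e$). For $S\subseteq X$, the cut semi-metric is $\delta_S(x,y)=1$ if exactly one of $x,y$ belongs to $S$, and $\delta_S(x,y)=0$ otherwise. The tree distance decomposes as $d_{T,w}=\sum_{e\in\mathcal E}w_e\delta_{S_e}$. $M_0(X)$ is the vector space of functions $\xi:X\to\mathbb R$ with $\sum_{x\in X}\xi(x)=0$. For non-negative numbers $C=\{\lambda_S\}_{S\subseteq X}$ the cut (semi-)norm is $\|\xi\|_C=\sum_{S\subseteq X}\lambda_S\big|\sum_{x\in S}\xi(x)\big|$; here $C=\{w_e\}$ means $\lambda_{S_e}=w_e$ for $e\in\mathcal E$ and $\lambda_S=0$ for all other $S$. The Arens–Eells norm for a distance $d$ on $X$ (here $d=d_{T,w}$)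 is $$\|\xi\|_{\text{Æ}}=\inf\Big\{\sum_{x,y\in X}|a(x,y)|\,d(x,y)\ :\ a\in\mathbb R^{X\times X},\ \xi=\sum_{x,y\in X}a(x,y)(\delta_x-\delta_y)\Big\},$$ where, with a single point as index, $\delta_x$ denotes the indicator function of $\{x\}$. *)

(* Defs.v *)
From mathcomp Require Import all_boot all_order all_algebra.
From mathcomp Require Import boolp classical_sets functions reals.

Set Implicit Arguments.
Unset Strict Implicit.
Unset Printing Implicit Defensive.

Import Order.TTheory GRing.Theory Num.Theory.
Local Open Scope ring_scope.

Section Graph.
Variable X : finType.

(* A graph on X is given by its set E of edges, an edge being an unordered
   pair [set x; y]. *)
Definition adj (E : {set {set X}}) : rel X := [rel x y | [set x; y]%SET \in E].

Definition simple_graph (E : {set {set X}}) : Prop :=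
  forall e, e \in E -> #|e| = 2.

Definition connected_graph (E : {set {set X}}) : Prop :=
  forall x y, connect (adj E) x y.

(* [ucycle] also accepts [:: x; y] with x and y adjacent, which merely runs
   back and forth along one edge; hence the bound on the size. *)
Definition acyclic_graph (E : {set {set X}}) : Prop :=
  forall c : seq X, (2 < size c)%N -> ~ ucycle (adj E) c.

Definition components (E : {set {set X}}) : {set {set X}} :=
  equivalence_partition (connect (adj E)) [set: X]%SET.

Definition simple_path (E : {set {set X}}) (x y : X) (p : seq X) : bool :=
  [&& path (adj E) x p, last x p == y & uniq (x :: p)].

Lemma simple_path_ex (E : {set {set X}}) (x y : X) :
  connected_graph E -> exists p, simple_path E x y p.
Proof.
move=> /(_ x y) /connectP[p pP ->].
by case: (shortenP pP) => q qP uq _; exists q; rewrite /simple_path qP uq eqxx.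
Qed.

End Graph.

(* The values of the weight outside of the edge set are irrelevant. *)
Record weighted_tree (R : realType) (X : finType) := WeightedTree {
  edges : {set {set X}};
  weight : {set X} -> R;
  edges_simple : simple_graph edges;
  edges_connected : connected_graph edges;
  edges_acyclic : acyclic_graph edges;
  weight_gt0 : forall e, e \in edges -> 0 < weight e
}.

Section Tree.
Variables (R : realType) (X : finType) (T : weighted_tree R X).

(* The simple path from x to y (unique, as T is a tree), without its starting
   point x. *)
Definition tree_path (x y : X) : seq X :=
  xchoose (simple_path_ex x y (edges_connected T)).

Definition tree_dist (x y : X) : R :=
  \sum_(e <- pairmap (fun u v => [set u; v]%SET) x (tree_path x y)) weight T e.

(* S chooses, for every edge e, one of the two components of T minus e. *)
Definition edge_side_choice (S : {set X} -> {set X}) : Prop :=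
  forall e, e \in edges T -> S e \in components (edges T :\ e).

(* The family C = {w_e}: the coefficient of S e is the weight of e, all other
   coefficients are 0.  For an [edge_side_choice] S, an edge e is determined by
   S e, being the only edge between S e and its complement. *)
Definition edge_cut_family (S : {set X} -> {set X}) (A : {set X}) : R :=
  if [pick e in edges T | S e == A] is Some e then weight T e else 0.

End Tree.

Section Norms.
Variables (R : realType) (X : finType).

Definition M0 : {pred X -> R} := [pred xi : X -> R | \sum_x xi x == 0].

Definition cut_norm (lambda : {set X} -> R) (xi : X -> R) : R :=
  \sum_(A : {set X}) lambda A * `| \sum_(x in A) xi x |.

Definition delta (x : X) : X -> R^o := fun z => (z == x)%:R.

(* For xi in M0 the infimum is over a nonempty set which, when d is
   nonnegative, is bounded below by 0, so that the real-valued [inf] is the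
   actual infimum. *)
Definition arens_eells_norm (d : X -> X -> R) (xi : X -> R) : R :=
  inf [set \sum_x \sum_y `|a x y| * d x y | a in
       [set a : X -> X -> R |
         xi = \sum_x \sum_y a x y *: (delta x - delta y)]]%classic.

End Norms.

(* Main.v *)
(* Lower bound: each side S_e contributes |sum_{S_e} xi| <= sum |a(x,y)| delta_{S_e}(x,y),
   and sum_e w_e delta_{S_e} is at most the length of any path.
   Upper bound: send the mass xi(S_e) across every edge e, from S_e to its complement.
   This has the right cost, and the net flow out of z is xi(z) because X minus z is
   the disjoint union, over the edges e at z, of the sides of e not containing z. *)
Require Import Defs.
From mathcomp Require Import all_boot all_order all_algebra.
From mathcomp Require Import boolp classical_sets functions reals.
From mathcomp Require Import ring.

Set Implicit Arguments.
Unset Strict Implicit.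
Unset Printing Implicit Defensive.

Import Order.TTheory GRing.Theory Num.Theory.
Local Open Scope ring_scope.

Section TreeSides.
Variables (R : realType) (X : finType) (T : weighted_tree R X).
Variables (S : {set X} -> {set X}) (hS : edge_side_choice T S).
Local Notation E := (edges T).
Local Notation edge x y := [set x; y]%SET.

(** * Edges and the sides they cut off *)

Lemma adj_connect_sym (F : {set {set X}}) : connect_sym (adj F).
Proof. by apply: sym_connect_sym => x y; rewrite /adj /= finset.setUC. Qed.

Lemma weight_ge0 e : e \in E -> 0 <= weight T e.
Proof. by move=> Ee; apply/ltW/weight_gt0. Qed.

Lemma edge_neq x y : edge x y \in E -> x != y.
Proof. by move/(edges_simple (w := T)); rewrite cards2; case: (x != y). Qed.

(** A longer simple path would close up with the edge into a cycle on at least three vertices. *)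
Lemma simple_path_edge x y p : edge x y \in E ->
  simple_path E x y p -> p = [:: y].
Proof.
move=> Exy /and3P[pth /eqP lst unq].
case: p => [|a [|b p]] in pth lst unq *.
- by move: (edge_neq Exy); rewrite -lst /= eqxx.
- by rewrite -lst.
- case: (edges_acyclic (w := T) (c := [:: x, a, b & p])) => //.
  rewrite /ucycle unq andbT /cycle rcons_path pth.
  by rewrite lst /adj /= finset.setUC.
Qed.

Lemma side_other_edge e x y : e \in E -> edge x y \in E -> edge x y != e ->
  (x \in S e) = (y \in S e).
Proof.
move=> /hS /imsetP[z _ ->] Exy ne; rewrite !inE /=.
apply: (same_connect_r (@adj_connect_sym _)); apply: connect1.
by rewrite /adj /= !inE ne.
Qed.

Lemma side_edge x y : edge x y \in E -> (y \in S (edge x y)) = (x \notin S (edge x y)).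
Proof.
move=> Exy; set e := (edge x y) in Exy *.
have [z def_S] : exists z, S e = [set t | connect (adj (E :\ e)) z t]%SET.
  by have /imsetP[z _ ->] := hS Exy; exists z; apply/setP=> t; rewrite !inE.
case xS: (x \in S e); case yS: (y \in S e) => //.
(* Both ends inside: a simple path that avoids the edge is also one in [T], hence the removed edge
   itself. *)
- have : connect (adj (E :\ e)) x y.
    move: xS yS; rewrite def_S !inE adj_connect_sym => xz; exact: connect_trans.
  case/connectP=> q /shortenP[p pth unq _] lst.
  have sub : subrel (adj (E :\ e)) (adj E).
    by move=> a b; rewrite /adj /= inE => /andP[].
  have pE : simple_path E x y p.
    by rewrite /simple_path unq lst eqxx (sub_path sub pth).
  move: pth; rewrite (simple_path_edge Exy pE) /= andbT /adj /= !inE.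
  by rewrite eqxx.
(* Both ends outside: no edge would leave [S e], which contains [z] but not [x], against
   connectedness. *)
- have clS : closed (adj E) (mem (S e)).
    move=> a b; rewrite /adj /= => Eab.
    have [eab|] := eqVneq (edge a b) e; last exact: side_other_edge.
    have outS t : t \in e -> (t \in S e) = false.
      by rewrite /e !inE => /orP[] /eqP->.
    by rewrite !outS // -eab !inE eqxx ?orbT.
  have := closed_connect clS (edges_connected T z x).
  by rewrite xS def_S inE connect0.
Qed.

(** The ends of [e] are separated by [S e] but lie on the same side of any other edge. Hence the
    [pick] in [edge_cut_family] is unambiguous. *)
Lemma side_inj : {in E &, injective S}.
Proof.
move=> e f Ee Ef eqS; case: (eqVneq e f) => // ne.
have /cards2P[x [y [_ def_e]]] : #|e| == 2 by apply/eqP; exact: (edges_simple (w := T)).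
have := side_edge (x := x) (y := y); rewrite -def_e eqS => /(_ Ee).
by rewrite -(side_other_edge (x := x) Ef) -?def_e //=; case: (x \in S f) => /=.
Qed.

(** Never visiting the end [z] of [e], the path cannot cross [e]. *)
Lemma side_avoiding_path e z x p : e \in E -> z \in e -> path (adj E) x p ->
  z \notin x :: p -> (x \in S e) = (last x p \in S e).
Proof.
move=> Ee ze; elim: p x => //= y p IHp x /andP[Exy pth].
rewrite inE negb_or => /andP[zx zp]; rewrite -(IHp y) //.
apply: side_other_edge => //; apply: contraNneq zp => def_e.
move: ze; rewrite -def_e !inE (negbTE zx) /= => /eqP->; exact: mem_head.
Qed.

(** * Signed cut functions and the tree distance *)

(** The absolute value is the cut semi-metric of [S e]; the sign makes it additive along paths. *)
Definition side_diff (e : {set X}) (x y : X) : R :=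
  (x \in S e)%:R - (y \in S e)%:R.

Lemma side_diff_edge_sqr x y : edge x y \in E -> side_diff (edge x y) x y ^+ 2 = 1.
Proof.
move/side_edge; rewrite /side_diff => ->.
by case: (x \in _); rewrite /= ?subr0 ?sub0r ?sqrrN expr1n.
Qed.

(* Exactly one edge at z separates z from t, the first one on the path. *)
Lemma sum_side_diff_star z t :
  \sum_(y | edge z y \in E) side_diff (edge z y) z y * side_diff (edge z y) z t
  = (t != z)%:R.
Proof.
have [->|tz] := eqVneq t z.
  by rewrite big1 // => y _; rewrite [X in _ * X]subrr mulr0.
have [p /and3P[]] := simple_path_ex z t (edges_connected T).
case: p => [|y p] /=; first by move=> _ /eqP zt; rewrite zt eqxx in tz.
move=> /andP[Ezy pth] /eqP lst /andP[zp _].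
(* The rest of the path avoids [z], so no edge at [z] separates [t] from [y]. *)
have zt e : e \in E -> z \in e -> side_diff e z t = side_diff e z y.
  move=> Ee ze; rewrite /side_diff -lst.
  by rewrite (side_avoiding_path Ee ze pth zp).
rewrite (bigD1 y) //= big1 => [|y' /andP[Ezy' ne]].
  by rewrite addr0 zt ?side_diff_edge_sqr -?expr2 ?side_diff_edge_sqr ?inE ?eqxx.
rewrite zt ?inE ?eqxx // /side_diff (side_other_edge Ezy' Ezy) ?subrr ?mulr0 //.
apply: contraNneq ne => eq_e.
have := set22 z y; rewrite eq_e !inE eq_sym => /orP[/eqP yz|]; last by rewrite eq_sym.
by have := edge_neq Ezy; rewrite -yz eqxx.
Qed.

Lemma sum_side_diff_edge x y : edge x y \in E ->
  \sum_(e in E) weight T e * `|side_diff e x y| = weight T (edge x y).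
Proof.
move=> Exy; rewrite (bigD1 (edge x y)) //= big1 => [|e /andP[Ee ne]].
  have : `|side_diff (edge x y) x y| ^+ 2 == 1.
    by rewrite real_normK ?num_real // side_diff_edge_sqr.
  by rewrite sqrp_eq1 ?normr_ge0 // => /eqP->; rewrite mulr1 addr0.
by rewrite /side_diff (side_other_edge Ee Exy) 1?eq_sym // subrr normr0 mulr0.
Qed.

(** The first step crosses only its own edge; the triangle inequality for each cut adds the
    remaining path. *)
Lemma sum_side_diff_path x p : path (adj E) x p ->
  \sum_(e in E) weight T e * `|side_diff e x (last x p)|
  <= \sum_(e <- pairmap (fun u v => (edge u v)) x p) weight T e.
Proof.
elim: p x => [|y p IHp] x /=.
  by rewrite big_nil big1 // => e _; rewrite /side_diff subrr normr0 mulr0.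
move=> /andP[Exy /IHp {IHp}le_p]; rewrite big_cons -(sum_side_diff_edge Exy).
apply: le_trans _ (lerD (lexx _) le_p); rewrite -big_split /=.
apply: ler_sum => e Ee; rewrite -mulrDr ler_wpM2l ?weight_ge0 //.
apply: le_trans _ (ler_normD _ _); rewrite le_eqVlt; apply/orP; left.
by apply/eqP; congr `|_|; rewrite /side_diff; ring.
Qed.

Lemma tree_pathP x y : simple_path E x y (tree_path T x y).
Proof. exact: xchooseP. Qed.

Lemma sum_side_diff_le_tree_dist x y :
  \sum_(e in E) weight T e * `|side_diff e x y| <= tree_dist T x y.
Proof.
have /and3P[pth /eqP lst _] := tree_pathP x y.
by have := sum_side_diff_path pth; rewrite lst.
Qed.

Lemma tree_dist_edge x y : edge x y \in E -> tree_dist T x y = weight T (edge x y).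
Proof.
move=> Exy; rewrite /tree_dist (simple_path_edge Exy (tree_pathP x y)) /=.
by rewrite big_seq1.
Qed.

(** * The flow attaining the infimum *)

(** Only the orientation leaving [S e] carries flow, so each edge is paid for once; a negative value
    means transport backwards. *)
Definition edge_flow (xi : X -> R) (x y : X) : R :=
  if [&& edge x y \in E, x \in S (edge x y) & y \notin S (edge x y)]
  then \sum_(t in S (edge x y)) xi t else 0.

Lemma edge_flow_net (xi : X -> R) x y : edge_flow xi x y - edge_flow xi y x =
  if edge x y \in E then side_diff (edge x y) x y * \sum_(t in S (edge x y)) xi t
  else 0.
Proof.
rewrite /edge_flow [edge y x]finset.setUC /side_diff.
have [Exy|_] /= := boolP (edge x y \in E); last by rewrite subrr.
by rewrite side_edge //; case: (x \in S _) => /=; ring.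
Qed.

(** As [xi] has total mass zero, the constant [(z \in S e)%:R] drops out. The mass of a side is thus
    expressed through separations from a base point [z]. *)
Lemma sum_side_diff (xi : X -> R) e z : \sum_x xi x = 0 ->
  \sum_t xi t * side_diff e z t = - \sum_(t in S e) xi t.
Proof.
move=> xi0; under eq_bigr do rewrite /side_diff mulrBr.
rewrite big_split /= -mulr_suml xi0 mul0r add0r sumrN; congr (- _).
rewrite [RHS]big_mkcond; apply: eq_bigr => t _.
by case: ifP; rewrite ?mulr1 ?mulr0.
Qed.

Lemma sum_edge_flow_net (xi : X -> R) z : \sum_x xi x = 0 ->
  \sum_y (edge_flow xi z y - edge_flow xi y z) = xi z.
Proof.
move=> xi0; under eq_bigr do rewrite edge_flow_net.
rewrite -big_mkcond /=.
(* With base point [z] and the sums exchanged, the coefficient of [xi t] is the star sum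
   [(t != z)%:R]; the mass off [z] is [- xi z]. *)
under eq_bigr do rewrite -[X in _ * X]opprK -(sum_side_diff _ z xi0) mulrN mulr_sumr.
rewrite sumrN exchange_big /=.
under eq_bigr do (under eq_bigr do rewrite mulrCA; rewrite -mulr_sumr sum_side_diff_star).
have := xi0; rewrite (bigD1 z) //= => /(canRL (addrK _)) ->.
rewrite sub0r; congr (- _).
rewrite [RHS]big_mkcond; apply: eq_bigr => t _.
by case: ifP; rewrite ?mulr1 ?mulr0.
Qed.

Lemma edge_flow_cost (xi : X -> R) :
  \sum_x \sum_y `|edge_flow xi x y| * tree_dist T x y =
  \sum_(e in E) weight T e * `|\sum_(x in S e) xi x|.
Proof.
rewrite pair_big /=.
pose out (q : X * X) :=
  [&& (edge q.1 q.2) \in E, q.1 \in S (edge q.1 q.2) & q.2 \notin S (edge q.1 q.2)].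
rewrite (bigID out) /= addrC big1 ?add0r => [|q nq]; last first.
  by rewrite /edge_flow -/(out q) (negbTE nq) normr0 mul0r.
(* Grouped by edge, the outgoing pairs form singletons [(u, v)], at distance the weight of the
   edge. *)
rewrite (partition_big (fun q => (edge q.1 q.2)) (mem E)) /= => [|q /andP[]//].
apply: eq_bigr => e Ee.
have [u [v [def_e uS vS]]] : exists u v, [/\ e = (edge u v), u \in S e & v \notin S e].
  have /cards2P[x [y [_ def_e]]] : #|e| == 2 by apply/eqP; exact: (edges_simple (w := T)).
  have := side_edge (x := x) (y := y); rewrite -def_e => /(_ Ee).
  case xS: (x \in S e) => /= yS; first by exists x, y; rewrite yS.
  by exists y, x; rewrite xS yS finset.setUC.
rewrite (big_pred1 (u, v)) => [|[x y]] /=.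
  rewrite tree_dist_edge -?def_e // mulrC.
  by rewrite /edge_flow -def_e Ee uS vS.
rewrite /out /= xpair_eqE; apply/idP/idP.
  case/andP=> /and3P[_ xS yS] /eqP eq_e; rewrite eq_e in xS yS.
  have := set21 x y; have := set22 x y; rewrite eq_e def_e !inE.
  case/orP=> /eqP y_; first by rewrite y_ uS in yS.
  case/orP=> /eqP x_; last by rewrite x_ (negbTE vS) in xS.
  by rewrite x_ y_ !eqxx.
by case/andP=> /eqP-> /eqP->; rewrite -def_e eqxx Ee uS vS.
Qed.

(** * Arbitrary representations and the lower bound *)

Lemma sum_deltaE (a : X -> X -> R) z :
  (\sum_x \sum_y a x y *: (delta R x - delta R y)) z =
  \sum_y (a z y - a y z).
Proof.
rewrite fct_sumE; under eq_bigr do rewrite fct_sumE.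
transitivity (\sum_x \sum_y (a x y * (z == x)%:R - a x y * (z == y)%:R)).
  by apply: eq_bigr => x _; apply: eq_bigr => y _; rewrite -mulrBr.
under eq_bigr do rewrite sumrB.
rewrite !sumrB; congr (_ - _).
  rewrite (bigD1 z) //= [X in _ + X]big1 => [|x xz].
    by rewrite addr0; apply: eq_bigr => y _; rewrite eqxx mulr1.
  by rewrite big1 // => y _; rewrite eq_sym (negbTE xz) mulr0.
apply: eq_bigr => x _; rewrite (bigD1 z) //= big1 ?eqxx ?mulr1 ?addr0 // => y yz.
by rewrite eq_sym (negbTE yz) mulr0.
Qed.

Lemma cut_sum_le_cost (a : X -> X -> R) (xi : X -> R) :
  xi = \sum_x \sum_y a x y *: (delta R x - delta R y) ->
  \sum_(e in E) weight T e * `|\sum_(x in S e) xi x|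
  <= \sum_x \sum_y `|a x y| * tree_dist T x y.
Proof.
move=> def_xi.
have side_xi e : \sum_(x in S e) xi x = \sum_x \sum_y a x y * side_diff e x y.
  (* Net outflow summed over [S e]; exchanging the roles of [x] and [y] in the inflow produces
     [side_diff]. *)
  transitivity (\sum_x \sum_y (x \in S e)%:R * a x y
                - \sum_x \sum_y (x \in S e)%:R * a y x).
    rewrite big_mkcond -sumrB; apply: eq_bigr => x _.
    rewrite def_xi sum_deltaE sumrB -!mulr_sumr.
    by case: (x \in S e); rewrite ?mul1r ?mul0r ?subrr.
  rewrite [X in _ - X]exchange_big -sumrB; apply: eq_bigr => x _.
  by rewrite -sumrB; apply: eq_bigr => y _; rewrite /side_diff; ring.
(* The triangle inequality is applied cut by cut; summing over edges first then bounds each pair by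
   its tree distance. *)
apply: (@le_trans _ _ (\sum_(e in E) \sum_x \sum_y
    `|a x y| * (weight T e * `|side_diff e x y|))).
  apply: ler_sum => e Ee.
  under [leRHS]eq_bigr do (under eq_bigr do rewrite mulrCA -normrM; rewrite -mulr_sumr).
  rewrite -mulr_sumr ler_wpM2l ?weight_ge0 // side_xi.
  apply: le_trans (ler_norm_sum _ _ _) _; apply: ler_sum => x _.
  exact: ler_norm_sum.
rewrite exchange_big /=; apply: ler_sum => x _.
rewrite exchange_big /=; apply: ler_sum => y _.
by rewrite -mulr_sumr ler_wpM2l ?sum_side_diff_le_tree_dist.
Qed.

(** * Cut norm and conclusion *)

(** Edges are grouped by their side: by [side_inj] a set [A] comes from at most one edge, and its
    term is 0 if it comes from none. *)
Lemma cut_norm_edge_cut_family (xi : X -> R) :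
  cut_norm (edge_cut_family T S) xi
  = \sum_(e in E) weight T e * `|\sum_(x in S e) xi x|.
Proof.
rewrite [RHS](partition_big S predT) //=; apply: eq_bigr => A _.
rewrite /edge_cut_family; case: pickP => [e /andP[Ee /eqP SeA]|noe].
  rewrite (big_pred1 e) ?SeA // => f; apply/idP/idP => [/andP[Ef]|/eqP->].
    by rewrite -SeA => /eqP /(side_inj Ef Ee) -> /=.
  by rewrite Ee SeA eqxx.
by rewrite mul0r big_pred0.
Qed.

Lemma arens_eells_norm_tree_dist (xi : X -> R) : \sum_x xi x = 0 ->
  arens_eells_norm (tree_dist T) xi
  = \sum_(e in E) weight T e * `|\sum_(x in S e) xi x|.
Proof.
move=> xi0; rewrite /arens_eells_norm; set A := (X in inf X).
set c := \sum_(e in E) _.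
(* [c] bounds all costs from below and is itself a cost, so the infimum is a minimum; this also
   gives the nonemptiness and boundedness that [inf] requires. *)
have lbA : lbound A c by move=> _ [a /= def_xi <-]; apply: cut_sum_le_cost.
have Ac : A c.
  exists (edge_flow xi); last exact: edge_flow_cost.
  by apply/funext => z; rewrite sum_deltaE sum_edge_flow_net.
apply/le_anti/andP; split; first by apply: ge_inf Ac; exists c.
by apply: lb_le_inf => //; exists c.
Qed.

End TreeSides.

Theorem theorem5 (R : realType) (X : finType) (T : weighted_tree R X)
    (S : {set X} -> {set X}) (hS : edge_side_choice T S)
    (xi : X -> R) (hxi : xi \in @M0 R X) :
  arens_eells_norm (tree_dist T) xi = cut_norm (edge_cut_family T S) xi /\
  cut_norm (edge_cut_family T S) xi
    = \sum_(e in edges T) weight T e * `| \sum_(x in S e) xi x |.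
Proof.
move: hxi; rewrite inE => /eqP xi0.
rewrite (cut_norm_edge_cut_family hS); split=> //.
exact: arens_eells_norm_tree_dist.
Qed.
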